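(* Let $q$ be a prime power, $1\le l\le k$ and $t\ge1$ integers, and let $f:\mathbb{F}_q^k\to\mathbb{F}_q^l$, $f(\mathbf{u})=\mathbf{F}\mathbf{u}$, be a linear function with $\mathbf{F}\in\mathbb{F}_q^{l\times k}$ and $\mathrm{rank}(\mathbf{F})=l$. If the number of distinct non-zero columns of $\mathbf{F}$ is exactly $l$, then there exists a selection of representative vectors $\mathbf{u}_0,\mathbf{u}_1,\dots,\mathbf{u}_{q^l-1}\in\mathbb{F}_q^k$ with $\{f(\mathbf{u}_0),\dots,f(\mathbf{u}_{q^l-1})\}=\mathrm{Im}(f)=\mathbb{F}_q^l$ such that, with $f_i:=f(\mathbf{u}_i)$, $$\mathbf{D}_f(t,f_0,f_1,\dots,f_{q^l-1})=\mathbf{D}_f(t,\mathbf{u}_0,\mathbf{u}_1,\dots,\mathbf{u}_{q^l-1}).$$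
   Context: $d_H$ is Hamming distance and $[x]^+=\max(x,0)$. For vectors $\mathbf{u}_0,\dots,\mathbf{u}_{M-1}\in\mathbb{F}_q^k$, the distance requirement matrix $\mathbf{D}_f(t,\mathbf{u}_0,\dots,\mathbf{u}_{M-1})$ is the $M\times M$ matrix whose $(i,j)$ entry is $[2t+1-d_H(\mathbf{u}_i,\mathbf{u}_j)]^+$ if $f(\mathbf{u}_i)\ne f(\mathbf{u}_j)$ and $0$ otherwise. For $f_i,f_j\in\mathrm{Im}(f)$, the function distance is $d_f(f_i,f_j)=\min\{d_H(\mathbf{u},\mathbf{u}'): f(\mathbf{u})=f_i,\ f(\mathbf{u}')=f_j\}$. The function distance matrix $\mathbf{D}_f(t,f_0,\dots,f_{q^l-1})$ (where $f_0,\dots,f_{q^l-1}$ enumerate $\mathrm{Im}(f)$) has $(i,j)$ entry $[2t+1-d_f(f_i,f_j)]^+$ if $i\ne j$ and $0$ if $i=j$. *)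

(* Defs.v *)
From HB Require Import structures.
From mathcomp Require Import all_boot all_order all_algebra.

Set Implicit Arguments.
Unset Strict Implicit.
Unset Printing Implicit Defensive.

Import GRing.Theory.
Local Open Scope ring_scope.

Definition hamming_dist (F : finType) (k : nat) (u v : 'cV[F]_k) : nat :=
  #|[set i : 'I_k | u i 0 != v i 0]|.

(* The truncated subtraction of nat renders [x]^+ = max(x, 0). *)
Definition dist_req_mx (F : finType) (k : nat) (Y : eqType)
    (f : 'cV[F]_k -> Y) (t M : nat) (u : 'I_M -> 'cV[F]_k) : 'M[nat]_M :=
  \matrix_(i, j) (if f (u i) != f (u j)
                  then (2 * t + 1 - hamming_dist (u i) (u j))%N else 0%N).

(* The default value k never exceeds the minimum when y and y' lie in the image
   of f, since Hamming distances in length k are at most k; fun_dist_le and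
   fun_dist_attained show that fun_dist is then the minimum. *)
Definition fun_dist (F : finType) (k : nat) (Y : eqType)
    (f : 'cV[F]_k -> Y) (y y' : Y) : nat :=
  \big[minn/k]_(p : 'cV[F]_k * 'cV[F]_k | (f p.1 == y) && (f p.2 == y'))
     hamming_dist p.1 p.2.

Definition fun_dist_mx (F : finType) (k : nat) (Y : eqType)
    (f : 'cV[F]_k -> Y) (t M : nat) (y : 'I_M -> Y) : 'M[nat]_M :=
  \matrix_(i, j) (if i != j
                  then (2 * t + 1 - fun_dist f (y i) (y j))%N else 0%N).

Lemma hamming_dist_le (F : finType) (k : nat) (u v : 'cV[F]_k) :
  (hamming_dist u v <= k)%N.
Proof. by rewrite -[X in (_ <= X)%N]card_ord max_card. Qed.

Lemma fun_dist_le (F : finType) (k : nat) (Y : eqType)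
    (f : 'cV[F]_k -> Y) (u v : 'cV[F]_k) :
  (fun_dist f (f u) (f v) <= hamming_dist u v)%N.
Proof.
rewrite /fun_dist; have := mem_index_enum (u, v).
elim: (index_enum _) => // p r IHr; rewrite inE big_cons.
case/predU1P=> [<-|/IHr le_r]; first by rewrite !eqxx geq_minl.
by case: ifP => // _; apply: leq_trans le_r; apply: geq_minr.
Qed.

Lemma fun_dist_attained (F : finType) (k : nat) (Y : eqType)
    (f : 'cV[F]_k -> Y) (u v : 'cV[F]_k) :
  exists u' v' : 'cV[F]_k, [/\ f u' = f u, f v' = f v
    & fun_dist f (f u) (f v) = hamming_dist u' v'].
Proof.
have [|] : fun_dist f (f u) (f v) = k \/
  exists p : 'cV[F]_k * 'cV[F]_k, [/\ f p.1 = f u, f p.2 = f v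
    & fun_dist f (f u) (f v) = hamming_dist p.1 p.2].
- rewrite /fun_dist; elim/big_ind: _ => [|x y hx hy|p /andP[/eqP h1 /eqP h2]].
  + by left.
  + by rewrite /minn; case: ifP.
  + by right; exists p.
- move=> dk; exists u, v; split=> //; apply/eqP.
  by rewrite eqn_leq fun_dist_le dk hamming_dist_le.
- by case=> -[u' v'] /= [h1 h2 h3]; exists u', v'.
Qed.

(* Main.v *)
(* The l distinct non-zero columns of A form an invertible matrix B, and
   A = B P where P is a 0/1 matrix whose columns are unit vectors or zero. Let Q
   insert l coordinates at positions where the columns of B occur in A, so that
   P Q = 1. The representative of y is Q B^-1 y. Multiplication by P or by Q
   does not increase Hamming distances, and the representatives of A u and A v
   are Q P u and Q P v, so their distance is minimal over all preimages. *)

Require Import Defs.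
From HB Require Import structures.
From mathcomp Require Import all_boot all_order all_algebra.

Set Implicit Arguments.
Unset Strict Implicit.
Unset Printing Implicit Defensive.

Import GRing.Theory.
Local Open Scope ring_scope.

(** If [P *m u] and [P *m v] differ at row [i], then [u] and [v] differ at some [j] with
    [P i j != 0]. Such a [j] determines [i], so there are at least as many differing [j] as
    differing [i]. *)
Lemma hamming_dist_mulmx (F : finFieldType) (m n : nat) (P : 'M[F]_(m, n))
    (u v : 'cV[F]_n) :
    (forall j i i', P i j != 0 -> P i' j != 0 -> i = i') ->
  (hamming_dist (P *m u) (P *m v) <= hamming_dist u v)%N.
Proof.
(* [h] is option-valued because a column of [P] may vanish; the differing rows are therefore counted
   through [Some]. *)
move=> Pcol; pose h j := [pick i | P i j != 0].
rewrite /hamming_dist -(card_imset _ (@Some_inj _)).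
apply: leq_trans (leq_imset_card h _); apply: subset_leq_card.
apply/subsetP=> _ /imsetP[i + ->]; rewrite inE => neq_i.
have /existsP[j /andP[neq_j Pij]] : [exists j, (u j 0 != v j 0) && (P i j != 0)].
  apply: contraNT neq_i => /existsPn eq_uv; rewrite !mxE; apply/eqP.
  apply: eq_bigr => j _; have := eq_uv j; rewrite negb_and !negbK.
  by case/orP=> /eqP->; rewrite ?mul0r.
apply/imsetP; exists j; first by rewrite inE.
rewrite /h; case: pickP => [i' Pi'j|/(_ i)]; last by rewrite Pij.
by rewrite (Pcol j i i').
Qed.

Lemma column_factorization (F : finFieldType) (l k : nat) (A : 'M[F]_(l, k)) :
    \rank A = l -> #|[set col j A | j : 'I_k & col j A != 0]| = l ->
  exists (B : 'M[F]_l) (P : 'M[F]_(l, k)) (Q : 'M[F]_(k, l)),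
    [/\ B \in unitmx, A = B *m P, P *m Q = 1%:M,
        forall j i i', P i j != 0 -> P i' j != 0 -> i = i'
      & forall j i i', Q i j != 0 -> Q i' j != 0 -> i = i'].
Proof.
set S := [set _ | _ in _] => rankA cardS.
pose c (i : 'I_l) : 'cV[F]_l := enum_val (cast_ord (esym cardS) i).
have c_inj : injective c by move=> i i' /enum_val_inj/cast_ord_inj.
have c_onto j : col j A != 0 -> exists i, col j A = c i.
  move=> nz_j; have Sj : col j A \in S by apply: imset_f; rewrite inE.
  exists (cast_ord cardS (enum_rank_in Sj (col j A))).
  by rewrite /c cast_ordK enum_rankK_in.
(* [s i] is a chosen position at which the column [c i] occurs in [A]; [Q] places coordinate [i]
   there. *)
have /fin_all_exists2[s nz_s sE] i : exists2 j, col j A != 0 & col j A = c i.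
  have /imsetP[j nz_j cE] := enum_valP (cast_ord (esym cardS) i).
  by exists j; rewrite // inE in nz_j.
have nz_c i : c i != 0 by rewrite -sE.
pose B : 'M[F]_l := \matrix_(i, j) c j i 0.
pose P : 'M[F]_(l, k) := \matrix_(i, j) (col j A == c i)%:R.
pose Q : 'M[F]_(k, l) := \matrix_(j, i) (j == s i)%:R.
have AE : A = B *m P.
  apply/matrixP=> i j; rewrite !mxE.
  transitivity (col j A i 0); first by rewrite mxE.
  (* A zero column of [A] gives a zero column of [P], as every [c i] is non-zero; any other gives a
     single 1, as [c] is injective. *)
  have [Aj0|/c_onto[i0 Aj]] := eqVneq (col j A) 0.
    rewrite Aj0 big1 ?mxE // => i' _.
    by rewrite !mxE Aj0 eq_sym (negPf (nz_c i')) mulr0.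
  rewrite Aj (bigD1 i0) //= big1 => [|i' neq].
    by rewrite !mxE Aj eqxx mulr1 addr0.
  by rewrite !mxE Aj (inj_eq c_inj) eq_sym (negPf neq) mulr0.
exists B, P, Q; split=> //.
- rewrite -row_free_unit /row_free eqn_leq rank_leq_row /=.
  by have := mxrankM_maxl B P; rewrite -AE rankA.
- apply/matrixP=> i i'; rewrite !mxE (bigD1 (s i')) //= big1 => [|j neq].
    by rewrite !mxE eqxx mulr1 addr0 sE (inj_eq c_inj) eq_sym.
  by rewrite !mxE (negPf neq) mulr0.
- move=> j i i'; rewrite !mxE; case: (col j A =P c i) => [->|] /=.
    by case: (c i =P c i') => [/c_inj|]; rewrite ?eqxx.
  by rewrite eqxx.
- move=> j i i'; rewrite !mxE.
  by case: (i =P s j) => [->|]; case: (i' =P s j) => [->|]; rewrite ?eqxx.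
Qed.

Theorem theorem10 (F : finFieldType) (q l k t : nat)
    (hq : #|F| = q) (hl : (1 <= l)%N) (hlk : (l <= k)%N) (ht : (1 <= t)%N)
    (A : 'M[F]_(l, k)) (f : 'cV[F]_k -> 'cV[F]_l)
    (hf : forall u : 'cV[F]_k, f u = A *m u)
    (hrank : \rank A = l)
    (hcols : #|[set col j A | j : 'I_k & col j A != 0]| = l) :
  exists u : 'I_(q ^ l) -> 'cV[F]_k,
    [/\ [set f (u i) | i : 'I_(q ^ l)] = [set f x | x : 'cV[F]_k],
        [set f x | x : 'cV[F]_k] = [set: 'cV[F]_l]
      & fun_dist_mx f t (fun i => f (u i)) = dist_req_mx f t u].
Proof.
have [B [P [Q [unitB AE PQ Pcol Qcol]]]] := column_factorization hrank hcols.
pose g (y : 'cV[F]_l) := Q *m (invmx B *m y).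
have gK y : f (g y) = y.
  by rewrite hf AE /g -mulmxA (mulmxA P) PQ mul1mx mulKVmx.
have gf x : g (f x) = Q *m (P *m x) by rewrite hf AE /g -mulmxA mulKmx.
have dist_g y y' : fun_dist f y y' = hamming_dist (g y) (g y').
  apply/eqP; rewrite eqn_leq -{1}(gK y) -{1}(gK y') fun_dist_le /=.
  (* For a minimizing pair [x], [x'], the map [g \o f] is multiplication by [P] and then by [Q], and
     neither increases the distance. *)
  have [x [x' []]] := fun_dist_attained f (g y) (g y').
  rewrite !gK => <- <- ->; rewrite !gf.
  by apply: leq_trans (hamming_dist_mulmx _ _ Qcol) (hamming_dist_mulmx _ _ Pcol).
have card_y : (q ^ l)%N = #|{: 'cV[F]_l}| by rewrite card_mx hq muln1.
pose y (i : 'I_(q ^ l)) : 'cV[F]_l := enum_val (cast_ord card_y i).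
have y_inj : injective y by move=> i j /enum_val_inj/cast_ord_inj.
have im_f : [set f x | x : 'cV[F]_k] = [set: 'cV[F]_l].
  by apply/setP=> z; rewrite inE -(gK z) imset_f.
exists (g \o y); split=> //.
- rewrite im_f; apply/setP=> z; rewrite inE; apply/imsetP.
  exists (cast_ord (esym card_y) (enum_rank z)) => //=.
  by rewrite gK /y cast_ordKV enum_rankK.
(* The two case conditions agree: the values [f (g (y i)) = y i] are distinct for distinct [i]. *)
- by apply/matrixP=> i j; rewrite !mxE /= !gK (inj_eq y_inj) dist_g.
Qed.
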